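(* Let $X$ be a finite set with $|X|=n$, let $\Omega$ be the set of $2$-element subsets of $X$, so $|\Omega|=\binom n2$, let $\Omega_m$ be the set of $m$-element subsets of $\Omega$, so $|\Omega_m|=\binom{|\Omega|}{m}$, and put $\overline m=\min(m,|\Omega|-m)$. If $m$ and $n$ tend to infinity in such a way that $$\kappa:=\liminf\;\frac{\overline m}{n\log n}>1,$$ then the number $g_{n,m}=|\Omega_m/S_n^2|$ of unlabelled graphs with $n$ vertices and $m$ edges has the asymptotics $$g_{n,m}=\frac{|\Omega_m|}{n!}\,(1+o(1)).$$
   Context: $\log$ is the natural logarithm. $S_n^2$ denotes the image of $\mathrm{Sym}(X)$ in $\mathrm{Sym}(\Omega)$ under its natural action on $2$-element subsets of $X$. Elements of $\Omega_m$ are labelled simple undirected graphs on the vertex set $X$ with $m$ edges; unlabelled graphs are orbits of $S_n^2$ on $\Omega_m$, and $g_{n,m}$ is the number of these orbits (isomorphism classes). The statement is along any sequence of pairs $(m,n)$ satisfying the conditions. *)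

(* Defs.v *)
From mathcomp Require Import all_boot all_fingroup.

Set Implicit Arguments.
Unset Strict Implicit.
Unset Printing Implicit Defensive.

Import GroupScope.

Definition edge (X : finType) : Type := {e : {set X} | #|e| == 2}.

Definition graphs (X : finType) (m : nat) : {set {set edge X}} :=
  [set G : {set edge X} | #|G| == m].

Lemma card_edge (X : finType) : #|{: edge X}| = 'C(#|X|, 2).
Proof. by rewrite card_sig -card_draws cardsE. Qed.

Lemma card_graphs (X : finType) (m : nat) :
  #|graphs X m| = 'C('C(#|X|, 2), m).
Proof. by rewrite card_draws card_edge. Qed.

Lemma card_edge_perm (X : finType) (e : edge X) (s : {perm X}) :
  #|[set s x | x in val e]| == 2.
Proof. by rewrite card_imset ?(valP e) //; exact: perm_inj. Qed.

Definition edge_perm (X : finType) (e : edge X) (s : {perm X}) : edge X :=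
  Sub [set s x | x in val e] (card_edge_perm e s).

Lemma edge_perm1 (X : finType) : (@edge_perm X)^~ 1%g =1 id.
Proof.
move=> e; apply: val_inj; rewrite /= -[RHS]imset_id.
by apply: eq_imset => x; rewrite perm1.
Qed.

Lemma edge_permM (X : finType) (e : edge X) (s t : {perm X}) :
  edge_perm e (s * t)%g = edge_perm (edge_perm e s) t.
Proof.
apply: val_inj; rewrite /= -imset_comp.
by apply: eq_imset => x; rewrite /= permM.
Qed.

Canonical edge_action (X : finType) : {action {perm X} &-> edge X} :=
  TotalAction (@edge_perm1 X) (@edge_permM X).

(* S_n^2: the image of Sym(X) in Sym(Omega), Omega being [edge X]. *)
Definition Sym2 (X : finType) : {set {perm edge X}} :=
  actperm (edge_action X) @* [set: {perm X}].
Canonical Sym2_group (X : finType) := [group of Sym2 X].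

(* 'P^* is the action of permutations of [edge X] on edge sets, i.e. on
   labelled graphs; the set of its orbits is Omega_m / S_n^2. *)
Definition unlabelled_graphs (X : finType) (m : nat) : {set {set {set edge X}}} :=
  [set orbit ('P^*) (Sym2 X) G | G in graphs X m].

Definition mbar (X : finType) (m : nat) : nat :=
  minn m (#|{: edge X}| - m)%N.

(* Main.v *)
Require Import Defs.
From mathcomp Require Import all_boot all_order all_algebra all_fingroup.
From mathcomp Require Import ring lra zify.
Set Implicit Arguments.
Unset Strict Implicit.
Unset Printing Implicit Defensive.
Import Order.TTheory GRing.Theory Num.Theory.
Local Open Scope ring_scope.

(** By Burnside's lemma, [n! g_(n,m)] is the sum over all [s] in [Sym(X)] of the
    number of [m]-edge graphs fixed by [s], and the identity contributes
    [|Omega_m|].  Put [N = |Omega|], [p = m / N], [q = 1 - p] and weight an edge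
    set [F] by [p^|F| q^(N - |F|)].  The fixed edge sets of [s] are the unions of
    its orbits on edges, so their total weight is the product of [p^l + q^l] over
    the orbit lengths [l]; as [p^l + q^l <= (p^2 + q^2)^(l/2)] for [l >= 2], it is
    at most [(1 - 2pq)^(M/2) <= exp (- pqM)] with [M] the number of moved edges.
    Since [m] is the mode of the binomial distribution [B(N, p)], the class of all
    [m]-edge sets has weight at least [1 / (N + 1)], so [s] fixes a proportion of
    at most [(N + 1) exp (- pqM)] of them.  If [s] moves [k] vertices, then
    [2M >= k (2n - k - 3)], whereas the hypothesis gives [Npq >= (1 + D) n log n]
    for some [D > 0]; hence this proportion is at most [n^(- (1 + D/2) k)].  There
    are at most [n^k] such [s], and summing over [k >= 2] leaves [o(1)]. *)

(** * Weights of the sets fixed by a permutation *)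

(* The inductive step is Cauchy-Schwarz for (p, q) and (p ^+ l, q ^+ l). *)
Lemma sumX_sqr_le (R : realDomainType) (p q : R) l : 0 <= p -> 0 <= q ->
  (2 <= l)%N -> (p ^+ l + q ^+ l) ^+ 2 <= (p ^+ 2 + q ^+ 2) ^+ l.
Proof.
move=> p0 q0; elim: l => // l IH; rewrite leq_eqVlt => /predU1P[<- //|].
rewrite ltnS => /IH {}IH; rewrite [leRHS]exprS.
apply: le_trans (ler_wpM2l _ IH); last by rewrite addr_ge0 ?sqr_ge0.
rewrite !exprS; have := exprn_ge0 l p0; have := exprn_ge0 l q0.
move: (p ^+ l) (q ^+ l) => u v u0 v0.
have h1 : 0 <= (p * v - q * u) ^+ 2 by rewrite sqr_ge0.
have h2 : 0 <= (p ^+ 2 + q ^+ 2) * (u * v) by rewrite !mulr_ge0 ?addr_ge0 ?sqr_ge0.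
lra.
Qed.

Lemma partition_porbits (T : finType) (s : {perm T}) : partition (porbits s) [set: T].
Proof.
apply/and3P; split.
- apply/eqP/setP => x; rewrite inE; apply/bigcupP.
  by exists (porbit s x); [exact: imset_f|exact: porbit_id].
- apply/trivIsetP => _ _ /imsetP[x _ ->] /imsetP[y _ ->]; apply: contraR.
  case/pred0Pn => z /andP[/= zx zy].
  by move: zx zy; rewrite -!eq_porbit_mem => /eqP <- /eqP <-.
- by apply/imsetP => -[x _ e0]; have := porbit_id s x; rewrite -e0 inE.
Qed.

Lemma porbit_sub_fixed (T : finType) (s : {perm T}) (F : {set T}) x :
  s @: F = F -> (porbit s x \subset F) = (x \in F).
Proof.
move=> sF; apply/idP/idP => [/subsetP|xF]; first by apply; exact: porbit_id.
apply/fintype.subsetP => y /porbitP[i ->].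
elim: i => [|i IH]; first by rewrite perm1.
by rewrite expgSr permM -sF imset_f.
Qed.

(** Expanding the product decides for each orbit whether it is taken. A fixed set is recovered from
    the orbits inside it, so distinct fixed sets give distinct terms of the expansion; the other
    terms are nonnegative. *)
Lemma sum_fixed_sets_le (R : realFieldType) (T : finType) (s : {perm T}) (p q : R) :
  0 <= p -> 0 <= q ->
  \sum_(F : {set T} | s @: F == F) p ^+ #|F| * q ^+ #|~: F| <=
  \prod_(C in porbits s) (p ^+ #|C| + q ^+ #|C|).
Proof.
move=> p0 q0.
(* Off the orbits the factor is [0 + 1], so the product may run over all sets [C], as in
   [bigA_distr]. *)
pose a (C : {set T}) := if C \in porbits s then p ^+ #|C| else 0.
pose b (C : {set T}) := if C \in porbits s then q ^+ #|C| else 1.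
have -> : \prod_(C in porbits s) (p ^+ #|C| + q ^+ #|C|) = \prod_C (a C + b C).
  rewrite big_mkcond; apply: eq_bigr => C _; rewrite /a /b.
  by case: ifP; rewrite ?add0r.
pose h (J : {set {set T}}) := \prod_C (if C \in J then a C else b C).
have h0 J : 0 <= h J.
  apply: prodr_ge0 => C _; rewrite /a /b.
  by case: ifP => _; case: ifP => _; rewrite ?exprn_ge0.
rewrite bigA_distr -/h.
pose J (F : {set T}) : {set {set T}} := [set C in porbits s | C \subset F].
have coverJ (F : {set T}) : s @: F == F -> cover (J F) = F.
  move=> /eqP sF; apply/setP => x; apply/bigcupP/idP => [[C]|xF].
    by rewrite inE => /andP[_ /fintype.subsetP]; apply.
  exists (porbit s x); rewrite ?porbit_id // inE porbit_sub_fixed // xF andbT.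
  exact: imset_f.
have wE (F : {set T}) : s @: F == F -> p ^+ #|F| * q ^+ #|~: F| = h (J F).
  move=> /eqP sF.
  have -> : p ^+ #|F| * q ^+ #|~: F| = \prod_(x in [set: T]) if x \in F then p else q.
    rewrite -[p ^+ _]prodr_const -[q ^+ _]prodr_const big_mkcond [X in _ * X]big_mkcond.
    rewrite -big_split /=.
    rewrite [RHS]big_mkcond; apply: eq_bigr => x _ /=; rewrite !inE.
    by case: (x \in F); rewrite ?mulr1 ?mul1r.
  rewrite (set_partition_big _ (partition_porbits s)) /= /h big_mkcond /=.
  apply: eq_bigr => C _; rewrite inE /a /b.
  case: ifP => //= /imsetP[x _ ->]; rewrite porbit_sub_fixed //.
  rewrite -(fun_if (fun z => z ^+ _)) -prodr_const; apply: eq_bigr => y.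
  by rewrite -eq_porbit_mem => /eqP e; rewrite -(porbit_sub_fixed _ sF) e porbit_sub_fixed.
rewrite (eq_bigr _ wE).
rewrite -(big_imset (h := J) (A := [pred F : {set T} | s @: F == F]) h) /=; last first.
  by move=> F G sF sG /(congr1 cover); rewrite !coverJ.
rewrite [leRHS](bigID (mem (J @: [pred F : {set T} | s @: F == F]))) /=.
by rewrite lerDl; apply: sumr_ge0 => C _; exact: h0.
Qed.

(** A fixed point contributes [p + q = 1]; by [sumX_sqr_le] a longer orbit contributes at most one
    factor [p ^+ 2 + q ^+ 2] per point. Squaring avoids the half-integral exponent. *)
Lemma sum_fixed_sets_sqr_le (R : realFieldType) (T : finType) (s : {perm T}) (p q : R) :
  0 <= p -> 0 <= q -> p + q = 1 ->
  (\sum_(F : {set T} | s @: F == F) p ^+ #|F| * q ^+ #|~: F|) ^+ 2 <=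
  (p ^+ 2 + q ^+ 2) ^+ #|[set x | s x != x]|.
Proof.
move=> p0 q0 pq1; set r := p ^+ 2 + q ^+ 2.
have r0 : 0 <= r by rewrite addr_ge0 ?sqr_ge0.
have -> : r ^+ #|[set x | s x != x]| =
    \prod_(C in porbits s) \prod_(x in C) if s x != x then r else 1.
  rewrite -(set_partition_big _ (partition_porbits s)) /= -prodr_const.
  by rewrite big_mkcond [RHS]big_mkcond; apply: eq_bigr => x _; rewrite !inE.
apply: le_trans (_ : (\prod_(C in porbits s) (p ^+ #|C| + q ^+ #|C|)) ^+ 2 <= _).
  rewrite lerXn2r ?nnegrE ?sum_fixed_sets_le //.
    by apply: sumr_ge0 => F _; rewrite mulr_ge0 ?exprn_ge0.
  by apply: prodr_ge0 => C _; rewrite addr_ge0 ?exprn_ge0.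
rewrite -prodrXl; apply: ler_prod => _ /imsetP[x _ ->]; rewrite sqr_ge0 /=.
have [sx|sx] := eqVneq (s x) x.
  have -> : porbit s x = [set x].
    apply/setP => y; rewrite inE; apply/porbitP/eqP => [[i ->]|->].
      by elim: i => [|i IH]; rewrite ?perm1 // expgSr permM IH.
    by exists 0%N; rewrite perm1.
  by rewrite cards1 big_set1 sx eqxx /= pq1 expr1n.
rewrite (eq_bigr (fun=> r)) => [|y]; last first.
  case/porbitP => i ->; rewrite -permM -expgSr expgS permM.
  by rewrite (inj_eq perm_inj) sx.
rewrite prodr_const sumX_sqr_le //.
have e2 : #|[set x; s x]| = 2 by rewrite cards2 eq_sym sx.
rewrite -[X in (X <= _)%N]e2; apply/subset_leq_card/fintype.subsetP => y; rewrite !inE.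
by case/orP => /eqP ->; [exact: porbit_id|exact: (mem_porbit s 1)].
Qed.

(** * The largest term of a binomial distribution *)

(** These are the probabilities of [B(N, m / N)] times [N ^ N]. For [m < N] the ratio of term
    [j + 1] to term [j] is [(N - j) m / ((j + 1) (N - m))], at least 1 for [j < m] and at most 1 for
    [j >= m]. *)
Lemma binomial_mode (N m k : nat) : (m <= N)%N -> (k <= N)%N ->
  ('C(N, k) * (m ^ k * (N - m) ^ (N - k)) <= 'C(N, m) * (m ^ m * (N - m) ^ (N - m)))%N.
Proof.
move=> mN.
pose b j := ('C(N, j) * (m ^ j * (N - m) ^ (N - j)))%N.
have bS j : (j < N)%N -> (b j.+1 * (j.+1 * (N - m)) = b j * ((N - j) * m))%N.
  move=> jN; have e := mul_bin_left N j; rewrite /b.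
  have -> : (N - j = (N - j.+1).+1)%N by lia.
  rewrite !expnS; have -> : ((N - j.+1).+1 = N - j)%N by lia.
  transitivity ((j.+1 * 'C(N, j.+1)) * (m * m ^ j * (N - m) ^ (N - j.+1) * (N - m)))%N;
    first by ring.
  by rewrite e; ring.
have up j : (j < m)%N -> (b j <= b j.+1)%N.
  move=> jm; have jN := leq_trans jm mN; have := bS _ jN.
  move: mN; rewrite leq_eqVlt => /predU1P[eN|mN] e.
    (* For [m = N] the factor [N - m] cannot be cancelled, but then [b j = 0] because [j < N]. *)
    by rewrite /b -eN subnn exp0n ?subn_gt0 // !muln0.
  rewrite -(@leq_pmul2r (j.+1 * (N - m))) ?muln_gt0 ?subn_gt0 //.
  by rewrite e leq_mul2l; apply/orP; right; nia.
have down j : (m <= j)%N -> (j < N)%N -> (b j.+1 <= b j)%N.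
  move=> mj jN; have := bS _ jN => e.
  have d0 : (0 < j.+1 * (N - m))%N by nia.
  by rewrite -(leq_pmul2r d0) e leq_mul2l; apply/orP; right; nia.
have low d : (d <= m)%N -> (b (m - d) <= b m)%N.
  elim: d => [|d IH] dm; first by rewrite subn0.
  apply: leq_trans (IH (ltnW dm)); have -> : (m - d = (m - d.+1).+1)%N by lia.
  by apply: up; lia.
have high d : (m + d <= N)%N -> (b (m + d) <= b m)%N.
  elim: d => [|d IH] dm; first by rewrite addn0.
  rewrite addnS in dm *; apply: leq_trans (IH (ltnW dm)).
  by apply: down => //; lia.
move=> kN; have [km|mk] := leqP k m.
  by have := low (m - k)%N (leq_subr _ _); rewrite subKn.
by have := high (k - m)%N; rewrite subnKC ?(ltnW mk) //; apply.
Qed.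

(** The expansion of [(m + (N - m)) ^ N] has [N + 1] terms, the [m]-th being the largest. *)
Lemma expn_le_binomial_mode (N m : nat) : (m <= N)%N ->
  (N ^ N <= N.+1 * ('C(N, m) * (m ^ m * (N - m) ^ (N - m))))%N.
Proof.
move=> mN; rewrite -{1}(subnK mN) expnDn.
rewrite -[X in (_ <= X * _)%N]card_ord -sum_nat_const leq_sum // => i _.
by rewrite [X in (_ * X)%N]mulnC binomial_mode // -ltnS.
Qed.

Lemma binomial_mass_ge (R : realFieldType) (N m : nat) (p : R) :
  (0 < N)%N -> (m <= N)%N -> p = m%:R / N%:R ->
  1 <= N.+1%:R * 'C(N, m)%:R * (p ^+ m * (1 - p) ^+ (N - m)).
Proof.
move=> N0 mN ->; have N0' : (N%:R : R) != 0 by rewrite pnatr_eq0 -lt0n.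
have -> : 1 - m%:R / N%:R = (N - m)%N%:R / N%:R :> R by rewrite natrB // mulrBl divff.
have := expn_le_binomial_mode mN; rewrite -(ler_nat R) !natrM !natrX => h.
rewrite !expr_div_n [X in _ * X]mulrACA -invfM -exprD subnKC // mulrA.
by rewrite ler_pdivlMr ?exprn_gt0 ?ltr0n // mul1r -mulrA.
Qed.

(** * Edges moved by a permutation of the vertices *)

Lemma mul_pred_bin2 n : (n * n.-1 = 2 * 'C(n, 2))%N.
Proof. by case: n => // n; rewrite -mul_bin_diag bin1. Qed.

Lemma natr_bin2 (R : numFieldType) n : 'C(n, 2)%:R = n%:R * (n%:R - 1) / 2 :> R.
Proof.
have -> : n%:R * (n%:R - 1) = (n * n.-1)%N%:R :> R.
  by case: n => [|n]; rewrite ?mul0r // natrM -[n.+1.-1%:R]/(n%:R) -natr1 addrK.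
by rewrite mul_pred_bin2 natrM mulrC mulKf ?pnatr_eq0.
Qed.

(* An edge fixed by [s] and meeting the support of [s] is of the form {x, s x}. *)
Lemma card_moved_edges_ge (X : finType) (s : {perm X}) :
  (#|[set x | s x != x]| * (2 * #|X| - #|[set x | s x != x]| - 3) <=
   2 * #|[set e : edge X | edge_perm e s != e]|)%N.
Proof.
set S := [set x | s x != x]; set k := #|S|.
pose A := [set e : edge X | edge_perm e s == e].
have -> : [set e : edge X | edge_perm e s != e] = ~: A by apply/setP => e; rewrite !inE.
have cA := cardsC A; rewrite card_edge in cA.
pose B := [set e : edge X | val e \subset ~: S].
pose D := [set e : edge X | val e \in [set [set x; s x] | x in S]].
have cB : (#|B| <= 'C(#|X| - k, 2))%N.
  have -> : (#|X| - k = #|~: S|)%N by rewrite -(cardsC S) addKn.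
  rewrite -cards_draws -(card_imset _ val_inj) subset_leq_card //.
  apply/fintype.subsetP => _ /imsetP[e eB ->]; rewrite !inE in eB *.
  by rewrite eB /=; exact: (valP e).
have cD : (#|D| <= k)%N.
  apply: leq_trans (leq_imset_card (fun x => [set x; s x]) S).
  rewrite -(card_imset _ val_inj) subset_leq_card //.
  by apply/fintype.subsetP => _ /imsetP[e eD ->]; rewrite inE in eD.
have AB : A \subset B :|: D.
  apply/fintype.subsetP => e; rewrite !inE -(inj_eq val_inj) /= => /eqP se.
  have [//|/subsetPn[x xe]] := boolP (val e \subset _).
  rewrite !inE negbK => sx /=; apply/imsetP; exists x; rewrite ?inE //.
  apply/eqP; rewrite eq_sym eqEcard (eqP (valP e)) cards2 eq_sym sx /= andbT.
  by apply/fintype.subsetP => y; rewrite !inE => /orP[] /eqP -> //; rewrite -se imset_f.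
have cAB : (#|A| <= 'C(#|X| - k, 2) + k)%N.
  apply: leq_trans (subset_leq_card AB) _; apply: leq_trans (leq_card_setU _ _) _.
  exact: leq_add.
have kX : (k <= #|X|)%N by exact: max_card.
(* With [l = k], [j = n - k] and [h = n], the bound is [n (n - 1) - (n - k) (n - k - 1) - 2 k = k (2
   n - k - 3)]. *)
have arith (a b c d j l h : nat) : (j + l = h)%N -> (c + d = a)%N -> (c <= b + l)%N ->
    (j * j.-1 = 2 * b)%N -> (h * h.-1 = 2 * a)%N -> (l * (2 * h - l - 3) <= 2 * d)%N.
  move=> <- <- cbl; case: l cbl => // l cbl; case: j => [|j]; first by rewrite add0n /=; nia.
  rewrite addSn !succnK => eb ea; nia.
exact: arith (subnK kX) cA cAB (mul_pred_bin2 _) (mul_pred_bin2 _).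
Qed.

(** * Orbit counting and permutations of given support *)

(** Burnside's lemma is applied to [{perm X}] rather than to its image [Sym2 X]: the orbits agree,
    and the group order is [n!] even for [n = 2], when the image is trivial. *)
Lemma card_unlabelled_graphs (X : finType) (m : nat) :
  (#|unlabelled_graphs X m| * #|X|`! =
   \sum_(s : {perm X})
     #|[set G in graphs X m | actperm (edge_action X) s @: G == G]|)%N.
Proof.
pose to := (edge_action X)^*%act.
have toE (G : {set edge X}) s : to G s = actperm (edge_action X) s @: G.
  by rewrite /to /= /setact; apply: eq_imset => e; rewrite actpermE.
have orbE G : orbit 'P^* (Sym2 X) G = orbit to [set: {perm X}] G.
  rewrite /orbit /Sym2 morphimEdom -imset_comp; apply: eq_imset => s /=.
  by rewrite toE /setact; apply: eq_imset => e; rewrite /= apermE.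
have acts_graphs : [acts [set: {perm X}], on graphs X m | to].
  apply/actsP => s _ G; rewrite !inE toE card_imset //; exact: perm_inj.
have := Frobenius_Cauchy acts_graphs.
have -> : #|[set: {perm X}]| = (#|X|)`!.
  rewrite -[#|X|]cardsT -card_perm; apply: eq_card => s; rewrite !inE.
  by apply/esym/fintype.subsetP => x; rewrite inE.
rewrite /unlabelled_graphs (eq_imset _ orbE) => <-.
apply: eq_big => [s|s _]; first by rewrite inE.
by apply: eq_card => G; rewrite !inE sub1set !inE toE.
Qed.

Lemma ffact_le_exp n k : (n ^_ k <= n ^ k)%N.
Proof.
rewrite ffact_prod -[X in (_ <= _ ^ X)%N](card_ord k) -prod_nat_const.
by apply: leq_prod => i _; exact: leq_subr.
Qed.

(** Choosing the support and then a permutation on it leaves at most ['C(n, k) k! = n ^_ k]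
    possibilities. *)
Lemma card_perm_support_le (X : finType) (k : nat) :
  (#|[set s : {perm X} | #|[set x | s x != x]| == k]| <= #|X| ^ k)%N.
Proof.
apply: leq_trans (ffact_le_exp _ _).
rewrite -bin_ffact -card_draws -sum_nat_const -sum1_card.
rewrite (partition_big (fun s : {perm X} => [set x | s x != x])
  (fun S => S \in [set S : {set X} | #|S| == k])) /= => [|s]; last by rewrite !inE.
apply: leq_sum => S; rewrite inE => /eqP <-.
rewrite -card_perm sum1_card subset_leq_card //.
apply/fintype.subsetP => s /andP[_ /eqP <-]; apply/fintype.subsetP => x.
by rewrite inE.
Qed.

Lemma card_support_neq1 (X : finType) (s : {perm X}) :
  s != 1%g -> (1 < #|[set x | s x != x]|)%N.
Proof.
move=> s1; have [x sx] : exists x, s x != x.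
  by apply/existsP; apply: contraR s1 => /existsPn h; apply/eqP/permP => x;
    rewrite perm1; apply/eqP; rewrite -[_ == _]negbK h.
have <- : #|[set x; s x]| = 2%N by rewrite cards2 eq_sym sx.
apply/subset_leq_card/fintype.subsetP => y; rewrite !inE.
by case/orP => /eqP ->; rewrite ?(inj_eq perm_inj).
Qed.

Lemma sum_perm_support_le (R : realFieldType) (X : finType) (z : R) : 0 <= z ->
  \sum_(s : {perm X} | s != 1%g) z ^+ #|[set x | s x != x]| <=
  \sum_(2 <= k < #|X|.+1) (#|X|%:R * z) ^+ k.
Proof.
move=> z0; rewrite big_geq_mkord.
rewrite (partition_big (fun s : {perm X} => inord #|[set x | s x != x]| : 'I_#|X|.+1)
  (fun k => (1 < k)%N)) /= => [|s s1]; last first.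
  by rewrite inordK ?card_support_neq1 // ltnS max_card.
apply: ler_sum => k k2.
apply: le_trans (_ : \sum_(s in [set s : {perm X} | #|[set x | s x != x]| == k]) z ^+ k <= _).
  rewrite big_mkcond [leRHS]big_mkcond; apply: ler_sum => s _ /=.
  rewrite inE; have -> : (inord #|[set x | s x != x]| == k) = (#|[set x | s x != x]| == k).
    by rewrite -val_eqE /= inordK // ltnS max_card.
  have [->|_] := eqVneq _ (k : nat); last by rewrite andbF.
  by case: ifP; rewrite ?exprn_ge0.
rewrite sumr_const exprMn -[leLHS]mulr_natl -natrX ler_wpM2r ?exprn_ge0 //.
by rewrite ler_nat card_perm_support_le.
Qed.

(* Bounds for a fixed vertex set *)
From mathcomp Require Import all_classical all_reals all_analysis.
Import numFieldNormedType.Exports.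

(** All [m]-sets have the same weight [w]. The [c] fixed ones weigh [c w <= E] together, while all
    [C] of them weigh at least [1 / (N + 1)]; hence [c <= c (N + 1) C w <= (N + 1) C E]. *)
Lemma card_fixed_sets_le (R : realType) (T : finType) (s : {perm T}) (m : nat) (p : R) :
  (0 < #|T|)%N -> (m <= #|T|)%N -> p = m%:R / #|T|%:R ->
  #|[set F : {set T} | (#|F| == m) && (s @: F == F)]|%:R <=
  'C(#|T|, m)%:R * (#|T|.+1%:R * expR (- (p * (1 - p) * #|[set x | s x != x]|%:R))).
Proof.
move=> T0 mT pE; set E := expR _; set M := #|[set x | _]| in E *.
have N0 : 0 < #|T|%:R :> R by rewrite ltr0n.
have p0 : 0 <= p by rewrite pE divr_ge0.
have q0 : 0 <= 1 - p by rewrite subr_ge0 pE ler_pdivrMr // mul1r ler_nat.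
pose W := \sum_(F : {set T} | s @: F == F) p ^+ #|F| * (1 - p) ^+ #|~: F|.
have WE : W <= E.
  have EW : E ^+ 2 = expR (- (2 * p * (1 - p))) ^+ M.
    by rewrite -!expRM_natr; congr expR; ring.
  rewrite -(@ler_pXn2r _ 2) ?nnegrE ?expR_ge0 //; last first.
    by apply: sumr_ge0 => F _; rewrite mulr_ge0 ?exprn_ge0.
  apply: le_trans (sum_fixed_sets_sqr_le s p0 q0 _) _; first by ring.
  rewrite EW lerXn2r ?nnegrE ?expR_ge0 ?addr_ge0 ?sqr_ge0 //.
  by apply: le_trans (expR_ge1Dx _); rewrite le_eqVlt; apply/orP; left; apply/eqP; ring.
set c := #|_|; have cW : c%:R * (p ^+ m * (1 - p) ^+ (#|T| - m)) <= W.
  rewrite /c mulr_natl -sumr_const big_mkcond [leRHS]big_mkcond.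
  apply: ler_sum => F _; rewrite inE.
  case: eqP => [Fm|_] /=; last by case: ifP; rewrite // mulr_ge0 ?exprn_ge0.
  by case: ifP => // _; rewrite -(cardsC F) Fm addKn.
have := binomial_mass_ge T0 mT pE.
set w := p ^+ m * _ in cW *; set C := 'C(_, _)%:R; set N1 := _.+1%:R => h.
apply: le_trans (_ : c%:R * (N1 * C * w) <= _); first by rewrite ler_peMr.
have -> : c%:R * (N1 * C * w) = C * (N1 * (c%:R * w)) by ring.
by rewrite !ler_wpM2l ?(le_trans cW).
Qed.

Lemma sum_geometric_ge2_le (R : realFieldType) (y : R) (n : nat) :
  0 <= y -> y <= 2^-1 -> \sum_(2 <= k < n) y ^+ k <= y.
Proof.
move=> y0 y2; case: n => [|[|n]]; [by rewrite big_geq|by rewrite big_geq|].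
have -> : \sum_(2 <= k < n.+2) y ^+ k = \sum_(i < n) y ^+ 2 * y ^+ i.
  rewrite -(big_mkord xpredT (fun i => y ^+ 2 * y ^+ i)) big_add1 big_add1.
  by apply: eq_bigr => i _; rewrite -exprD.
rewrite -big_distrr /= expr2 -mulrA ler_piMr //.
have := subrX1 y n; have := exprn_ge0 n y0.
move: (\sum_(i < n) _) (y ^+ n) => S z z0 e.
(* As [y <= 1 - y], one has [y S <= (1 - y) S = 1 - z <= 1]. *)
nra.
Qed.

(** In the exponent condition [k] is a support size. The term [2 ln n] absorbs [N + 1 <= n ^ 2];
    what remains gives a proportion [n ^ (- (1 + d) k)] of fixed graphs. Summed over at most [n ^ k]
    permutations for each [k >= 2], this is a geometric series in [n ^ (- d)]. The lower bound comes
    from the identity alone. *)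
Lemma unlabelled_graphs_bounds (R : realType) (X : finType) (m : nat) (d : R) :
  let n := #|X| in let N := #|{: edge X}| in
  let p : R := m%:R / N%:R in
  (2 < n)%N -> (m <= N)%N -> expR (- (d * ln n%:R)) <= 2^-1 ->
  (forall k : nat, (2 <= k)%N -> (k <= n)%N ->
     ((1 + d) * k%:R + 2) * ln n%:R <= p * (1 - p) * ((k * (2 * n - k - 3))%N%:R / 2)) ->
  (#|graphs X m|%:R : R) <= #|unlabelled_graphs X m|%:R * (n`!)%:R <=
  #|graphs X m|%:R * (1 + expR (- (d * ln n%:R))).
Proof.
move=> n N p n2 mN; set y := expR _ => y2 H.
have n0 : 0 < n%:R :> R by rewrite ltr0n; lia.
have N0 : (0 < N)%N by rewrite /N card_edge bin_gt0; lia.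
have gE : #|graphs X m| = 'C(N, m) by rewrite card_draws.
pose fix_ (s : {perm X}) := #|[set G in graphs X m | actperm (edge_action X) s @: G == G]|.
have fixE (s : {perm X}) : fix_ s =
    #|[set F : {set edge X} | (#|F| == m) && (actperm (edge_action X) s @: F == F)]|.
  by apply: eq_card => G; rewrite !inE.
have fix1 : fix_ 1%g = #|graphs X m|.
  apply: eq_card => G; rewrite !inE morph1.
  have -> : (1%g : {perm edge X}) @: G = G.
    by rewrite -[RHS]imset_id; apply: eq_imset => e; rewrite perm1.
  by rewrite eqxx andbT.
pose z := expR (- ((1 + d) * ln n%:R)).
have nz : n%:R * z = y.
  by rewrite -{1}[n%:R]lnK ?posrE // -expRD; congr expR; rewrite /=; ring.
have p0 : 0 <= p by rewrite divr_ge0.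
have q0 : 0 <= 1 - p by rewrite subr_ge0 ler_pdivrMr ?ltr0n // mul1r ler_nat.
have fixle (s : {perm X}) : s != 1%g ->
    (fix_ s)%:R <= #|graphs X m|%:R * z ^+ #|[set x | s x != x]|.
  move=> s1; rewrite fixE.
  apply: le_trans (card_fixed_sets_le _ N0 mN (erefl p)) _.
  rewrite gE ler_wpM2l //; set k := #|[set x | s x != x]|.
  set M := #|[set x | _]|.
  have kM : (k * (2 * n - k - 3) <= 2 * M)%N.
    have -> : M = #|[set e : edge X | edge_perm e s != e]|.
      by apply: eq_card => e; rewrite !inE actpermE.
    exact: card_moved_edges_ge.
  have kn : (k <= n)%N by exact: max_card.
  have Hk := H _ (card_support_neq1 s1) kn; rewrite -/k in Hk.
  have N1 : N.+1%:R <= expR (2 * ln n%:R) :> R.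
    rewrite expRM_natl lnK ?posrE // -natrX ler_nat.
    by rewrite /N card_edge -/n bin2; nia.
  apply: le_trans (ler_wpM2r (expR_ge0 _) N1) _.
  rewrite -expRD -expRM_natr ler_expR.
  have kM' : (k * (2 * n - k - 3))%N%:R / 2 <= M%:R :> R.
    by rewrite ler_pdivrMr // mulrC -natrM ler_nat.
  have := ler_wpM2l (mulr_ge0 p0 q0) kM'.
  lra.
have sumle : \sum_(s : {perm X} | s != 1%g) (fix_ s)%:R <= #|graphs X m|%:R * y :> R.
  apply: le_trans (ler_sum _ fixle) _.
  rewrite -mulr_sumr ler_wpM2l //.
  apply: le_trans (sum_perm_support_le _ (expR_ge0 _)) _.
  by rewrite -/n nz sum_geometric_ge2_le ?expR_ge0.
rewrite -natrM card_unlabelled_graphs natr_sum (bigD1 1%g) //= -/(fix_ _) fix1.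
by rewrite lerDl sumr_ge0 //= mulrDr mulr1 lerD2l.
Qed.

(** * Numerical estimates *)

Lemma ln_le_sqrt (R : realType) (x : R) : 0 < x -> ln x <= 2 * Num.sqrt x.
Proof.
move=> x0; have r0 : 0 < Num.sqrt x by rewrite sqrtr_gt0.
rewrite -{1}(sqr_sqrtr (ltW x0)) lnXn // -[leLHS]mulr_natl ler_wpM2l //.
exact/ltW/ln_sublinear.
Qed.

(** Given [p q >= 2 (1 + D) ln n / (n - 1)], this yields the exponent condition of
    [unlabelled_graphs_bounds] with [d = D / 2]. The bound [8 <= D (n - 5)] is suggested by [k = n],
    where the claim reads [8 n - 4 <= D n (n - 5)]. *)
Lemma moved_edges_exponent_ge (R : realFieldType) (n k : nat) (D : R) :
  0 < D -> 8 <= D * (n%:R - 5) -> (2 <= k)%N -> (k <= n)%N ->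
  (n%:R - 1) * ((1 + D / 2) * k%:R + 2) <= (1 + D) * (k * (2 * n - k - 3))%N%:R.
Proof.
move=> D0 Dn k2 kn.
have n5 : (5 < n)%N.
  rewrite -(ltr_nat R) -subr_gt0 -(pmulr_rgt0 _ D0); exact: lt_le_trans Dn.
have -> : (k * (2 * n - k - 3))%N%:R = k%:R * (2 * n%:R - k%:R - 3) :> R.
  by rewrite natrM !natrB ?natrM //; lia.
have k2' : 2 <= k%:R :> R by rewrite ler_nat.
have kn' : k%:R <= n%:R :> R by rewrite ler_nat.
(* The difference of the two sides is the first product plus the second plus half the third plus
   2. *)
have h1 : 0 <= (k%:R - 2) * (n%:R - k%:R) :> R by rewrite mulr_ge0 ?subr_ge0.
have h2 : 0 <= D * (k%:R * (n%:R - k%:R)) by rewrite mulr_ge0 ?(ltW D0) // mulr_ge0 ?subr_ge0.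
have h3 : 0 <= k%:R * (D * (n%:R - 5) - 8) by rewrite mulr_ge0 ?subr_ge0.
lra.
Qed.

(** The function [a (N - a)] is concave and symmetric about [N / 2], so on [[u, N - u]] it is
    smallest at the ends. *)
Lemma mul_compl_ge (R : realDomainType) (a u N : R) :
  u <= a -> u <= N - a -> u * (N - u) <= a * (N - a).
Proof.
move=> ua uNa; have : 0 <= (a - u) * (N - a - u) by rewrite mulr_ge0 ?subr_ge0.
lra.
Qed.

(** With [u = (1 + 2 D) n ln n], [N p q = m (N - m) / N] is at least [u (N - u) / N]. The bound on
    [8 ln n] makes [u / N] so small that the factor [1 - u / N] costs only the passage from
    [1 + 2 D] to [1 + D]. *)
Lemma edge_variance_ge (R : realType) (X : finType) (m : nat) (D : R) :
  let n := #|X| in let N := #|{: edge X}| in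
  let p : R := m%:R / N%:R in
  (1 < n)%N -> (m <= N)%N -> 0 < D -> D <= 2^-1 -> 8 * ln n%:R <= D * (n%:R - 1) ->
  (1 + 2 * D) * (n%:R * ln n%:R) <= (mbar X m)%:R ->
  (1 + D) * (n%:R * ln n%:R) <= N%:R * (p * (1 - p)).
Proof.
move=> n N p n1 mN D0 D2 Dn; set L := ln _ in Dn *; set u := _ * _ => um.
have n1' : 1 < n%:R :> R by rewrite ltr1n.
have NE : N%:R = n%:R * (n%:R - 1) / 2 :> R.
  by rewrite /N card_edge natr_bin2.
have N0 : 0 < N%:R :> R by rewrite NE; nra.
have -> : N%:R * (p * (1 - p)) = (m%:R * (N%:R - m%:R)) / N%:R.
  by rewrite /p; field; rewrite gt_eqF.
have [mu mu'] : u <= m%:R /\ u <= N%:R - m%:R.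
  by split; apply: le_trans um _; rewrite -?natrB // ler_nat /mbar ?geq_minl ?geq_minr.
rewrite ler_pdivlMr //; apply: le_trans (mul_compl_ge mu mu').
have L0 : 0 <= L by exact/ln_ge0/ltW.
have key : (1 + D) * N%:R <= (1 + 2 * D) * (N%:R - u).
  have : (1 + 2 * D) * u <= D * N%:R.
    rewrite /u NE.
    have -> : D * (n%:R * (n%:R - 1) / 2) = n%:R * (D * (n%:R - 1) / 2) by ring.
    have -> : (1 + 2 * D) * ((1 + 2 * D) * (n%:R * L)) = n%:R * ((1 + 2 * D) ^+ 2 * L) by ring.
    rewrite ler_wpM2l //.
    have h : (1 + 2 * D) ^+ 2 * L <= 4 * L.
      by rewrite ler_wpM2r //; nra.
    lra.
  lra.
have nL : 0 <= n%:R * L by rewrite mulr_ge0.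
have := ler_wpM2l nL key.
rewrite /u; lra.
Qed.

(** * Explicit thresholds and passage to the limit *)

(** The first threshold makes [ln n] small against [D n], through [ln n <= 2 sqrt n]; the second
    gives [n ^ (- D / 2) <= exp (- 1 / e) <= e]. *)
Lemma unlabelled_graphs_ratio (R : realType) (X : finType) (m : nat) (D e : R) :
  let n := #|X| in
  0 < D -> D <= 2^-1 -> 0 < e -> e <= 2^-1 ->
  (32 / D) ^+ 2 <= n%:R -> expR (2 / (D * e)) <= n%:R ->
  (1 + 2 * D) * (n%:R * ln n%:R) <= (mbar X m)%:R ->
  (0 < #|graphs X m|)%N /\
  (#|graphs X m|%:R : R) <= #|unlabelled_graphs X m|%:R * (n`!)%:R <=
  #|graphs X m|%:R * (1 + e).
Proof.
move=> n D0 D2 e0 e2 nD ne nm; set L := ln n%:R in nm *.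
have D32 : 64 <= 32 / D by rewrite ler_pdivlMr //; lra.
have n64 : 64 <= n%:R :> R.
  apply: le_trans nD; rewrite expr2; nra.
have n64' : (64 <= n)%N by rewrite -(ler_nat R).
have n0 : 0 < n%:R :> R by lra.
have Ln : 2 / (D * e) <= L by rewrite -ler_expR lnK ?posrE.
have De0 : 0 < D * e by rewrite mulr_gt0.
have L0 : 0 < L by apply: lt_le_trans Ln; rewrite divr_gt0.
pose r := Num.sqrt (n%:R : R); have r2 : r ^+ 2 = n%:R by rewrite sqr_sqrtr ?(ltW n0).
have r0 : 0 <= r by exact: sqrtr_ge0.
have rD : 32 <= D * r.
  rewrite mulrC -ler_pdivrMr //.
  by rewrite -(@ler_pXn2r _ 2) ?nnegrE ?r2 //; lra.
have Dn : 32 * r <= D * n%:R by rewrite -r2 expr2 mulrA ler_wpM2r.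
have Lr : L <= 2 * r by exact: ln_le_sqrt.
have r8 : 8 <= r by rewrite -(@ler_pXn2r _ 2) ?nnegrE // r2; lra.
have m0 : (0 < mbar X m)%N.
  by rewrite -(ltr_nat R); apply: lt_le_trans nm; rewrite !mulr_gt0 ?addr_gt0 ?mulr_gt0.
(* The subtraction in [mbar] is truncated, so [0 < mbar X m] forces [m < N]. *)
have mN : (m <= #|{: edge X}|)%N.
  by move: m0; rewrite /mbar leq_min subn_gt0 => /andP[_ /ltnW].
split; first by rewrite card_graphs bin_gt0 -card_edge.
have n1 : (1 < n)%N by exact: leq_trans n64'.
have L8 : 8 * L <= D * (n%:R - 1) by lra.
have := edge_variance_ge n1 mN D0 D2 L8 nm; rewrite -/n -/L => P.
have ye : expR (- (D / 2 * L)) <= e.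
  rewrite expRN -[leRHS]invrK lef_pV2 ?posrE ?invr_gt0 ?expR_gt0 //.
  apply: le_trans (expR_ge1Dx _).
  have : e^-1 <= D / 2 * L.
    have := ler_wpM2l (_ : 0 <= D / 2) Ln.
    have -> : D / 2 * (2 / (D * e)) = e^-1 by field; rewrite !gt_eqF.
    by apply; lra.
  lra.
have n2 : (2 < n)%N by exact: leq_trans n64'.
have B := @unlabelled_graphs_bounds R X m (D / 2) n2 mN (le_trans ye e2).
suff H : forall k : nat, (2 <= k)%N -> (k <= n)%N ->
    ((1 + D / 2) * k%:R + 2) * L <=
    m%:R / #|{: edge X}|%:R * (1 - m%:R / #|{: edge X}|%:R) *
    ((k * (2 * n - k - 3))%N%:R / 2).
  have /andP[-> h /=] := B H.
  by apply: le_trans h _; rewrite ler_wpM2l // lerD2l.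
move=> k k2 kn.
have D8 : 8 <= D * (n%:R - 5) by lra.
have h := moved_edges_exponent_ge D0 D8 k2 kn.
set p := _ / _ in P *; set N := #|{: edge X}| in P *.
set t := (k * _)%N%:R in h *.
have NE : N%:R = n%:R * (n%:R - 1) / 2 :> R.
  by rewrite /N card_edge natr_bin2.
have t0 : 0 <= t by [].
have nn : 0 < n%:R * (n%:R - 1) :> R by rewrite mulr_gt0 //; lra.
(* Multiplied by [n (n - 1) = 2 N], the goal chains [h] times [n L] with [P] times [t]. *)
rewrite -(ler_pM2l nn).
have h1 := ler_wpM2l (mulr_ge0 (ltW n0) (ltW L0)) h.
have h2 := ler_wpM2r t0 P.
rewrite NE in h2; lra.
Qed.

Local Open Scope classical_set_scope.
Local Open Scope ring_scope.

(** The lower limit is the supremum of the tail infima, so one of them exceeds 1; half its excess,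
    capped at [2^-1] for [unlabelled_graphs_ratio], serves as [D]. *)
Lemma limn_einf_gt1_near (R : realType) (u : nat -> R) :
  (1%:E < limn_einf (EFin \o u))%E ->
  exists2 D : R, 0 < D <= 2^-1 & \forall k \near \oo, 1 + 2 * D <= u k.
Proof.
rewrite limn_einf_lim (cvg_lim _ (@cvg_einfs_sup R (EFin \o u))) //.
move=> /ereal_sup_gt[_ [k0 _ <-]] h.
suff [D D0 Dle] : exists2 D : R, 0 < D <= 2^-1 & ((1 + 2 * D)%:E <= einfs (EFin \o u) k0)%E.
  exists D => //; exists k0 => // k /= k0k; rewrite -lee_fin.
  by apply: le_trans Dle _; apply: ereal_inf_lbound; exists k.
case: (einfs _ _) h => [r| |] //.
  rewrite lte_fin => r1; exists (Num.min ((r - 1) / 2) 2^-1).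
    by rewrite lt_min ge_min lexx orbT andbT; apply/andP; split; lra.
  have : Num.min ((r - 1) / 2) 2^-1 <= (r - 1) / 2 by rewrite ge_min lexx.
  by rewrite lee_fin; lra.
by move=> _; exists 2^-1; rewrite ?leey // lexx andbT.
Qed.

Theorem mainTheorem5 (R : realType) (X : nat -> finType) (n m : nat -> nat)
    (cardX : forall k, #|X k| = n k)
    (n_oo : n k @[k --> \oo] --> \oo)
    (m_oo : m k @[k --> \oo] --> \oo)
    (kappa_gt1 : (1%:E <
       limn_einf (fun k : nat =>
         ((mbar (X k) (m k))%:R / ((n k)%:R * ln (n k)%:R) : R)%:E))%E) :
  exists eps : nat -> R,
    eps k @[k --> \oo] --> (0 : R) /\
    forall k, (#|unlabelled_graphs (X k) (m k)|%:R : R) =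
      #|graphs (X k) (m k)|%:R / ((n k)`!)%:R * (1 + eps k).
Proof.
have [D /andP[D0 D2] Dnear] := limn_einf_gt1_near kappa_gt1.
pose g k : R := #|graphs (X k) (m k)|%:R.
pose h k : R := #|unlabelled_graphs (X k) (m k)|%:R * ((n k)`!)%:R.
exists (fun k => h k / g k - 1); split; last first.
  move=> k; rewrite -/(g k) addrC subrK.
  have n0 : ((n k)`!)%:R != 0 :> R by rewrite pnatr_eq0 -lt0n fact_gt0.
  (* If no graph has [m] edges, division by zero makes [eps k = -1], and both sides of the equation
     vanish. *)
  have [g0|g0] := eqVneq (g k) 0; last by rewrite /h; field; rewrite ?g0 ?n0.
  rewrite g0 !mul0r; apply/eqP; rewrite pnatr_eq0 -leqn0.
  move/eqP: g0; rewrite pnatr_eq0 -leqn0; apply: leq_trans.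
  exact: leq_imset_card.
(* The cap at [2^-1] serves the geometric series, whose ratio must be at most one half. *)
apply/cvgrPdist_le => e0 e0_gt0; pose e := Num.min e0 2^-1.
have [e_gt0 [e2 ee0]] : 0 < e /\ e <= 2^-1 /\ e <= e0.
  by rewrite lt_min !ge_min !lexx orbT e0_gt0 invr_gt0 ltr0n.
have nge (A : R) : \forall k \near \oo, A <= (n k)%:R.
  have /cvgnyPge/(_ (Num.trunc A).+1) := n_oo.
  apply: filterS => k; rewrite -(ler_nat R); apply: le_trans.
  by have := real_truncnS_gt (num_real A) => /ltW.
near=> k.
have n2 : 2 <= (n k)%:R :> R by near: k; exact: nge.
have n_pos : 0 < (n k)%:R * ln (n k)%:R :> R by rewrite mulr_gt0 ?ln_gt0 //; lra.
have := @unlabelled_graphs_ratio R (X k) (m k) D e D0 D2 e_gt0 e2.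
rewrite cardX -/(g k) -/(h k) => /(_ _ _ _)[].
- by near: k; exact: nge.
- by near: k; exact: nge.
- by rewrite -ler_pdivlMr //; near: k.
move=> g0 /andP[gh hg]; have g_gt0 : 0 < g k by rewrite ltr0n.
rewrite distrC subr0 ger0_norm ?subr_ge0 ?ler_pdivlMr ?mul1r //.
by rewrite lerBlDr ler_pdivrMr // mulrC; apply: le_trans hg _; rewrite ler_wpM2l //; lra.
Unshelve.
all: by end_near.
Qed.
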